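(* For every integer $k\geq 1$, let $f(k)$ denote the minimum integer $d$ such that every graph of minimum degree at least $d$ contains $k$ pairwise vertex-disjoint cycles whose lengths are pairwise different. Then (a) $f(k)$ exists (i.e. such an integer $d$ exists), and (b) $f(k)=\dfrac{k^2+5k-2}{2}$.
   Context: All graphs are finite and simple. The length of a cycle is its number of vertices (equivalently, edges). *)

(* Defs.v *)
From mathcomp Require Import all_boot.
Set Implicit Arguments.
Unset Strict Implicit.
Unset Printing Implicit Defensive.

Record sgraph := SGraph {
  vertex :> finType;
  adj : rel vertex;
  adj_sym : symmetric adj;
  adj_irr : irreflexive adj }.

Definition degree (G : sgraph) (v : G) : nat := #|[set u | adj v u]|.

(* Every degree is smaller than #|G|, so the default value #|G| does not affect
   the minimum as soon as G has a vertex. *)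
Definition min_degree (G : sgraph) : nat := \big[minn/#|G|]_(v : G) degree v.

(* A cycle is given by the cyclic sequence of its (distinct) vertices, so that
   its length is the size of the sequence. [ucycle] alone also accepts the empty
   sequence and an edge traversed back and forth. *)
Definition is_cycle (G : sgraph) (c : seq G) : Prop :=
  ucycle (@adj G) c /\ 3 <= size c.

Definition has_disjoint_cycles_of_distinct_lengths (G : sgraph) (k : nat) :
    Prop :=
  exists C : 'I_k -> seq G,
    [/\ forall i, is_cycle (C i),
        forall i j, i != j -> [disjoint C i & C j]
      & forall i j, i != j -> size (C i) != size (C j)].

(* The minimum degree is only meaningful for graphs with at least one vertex. *)
Definition min_degree_forces (k d : nat) : Prop :=
  forall G : sgraph, 0 < #|G| -> d <= min_degree G ->
    has_disjoint_cycles_of_distinct_lengths G k.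

Definition is_minimum (P : nat -> Prop) (d : nat) : Prop :=
  P d /\ forall d', P d' -> d <= d'.

(* [is_f k d] is the graph of the partial function f: "f(k) exists and is d". *)
Definition is_f (k d : nat) : Prop := is_minimum (min_degree_forces k) d.

(* Main.v *)
Require Import Defs.
From HB Require Import structures.
From mathcomp Require Import all_boot all_order all_algebra.
From mathcomp Require Import zify ring.
Set Implicit Arguments.
Unset Strict Implicit.
Unset Printing Implicit Defensive.
Import GRing.Theory.
Local Open Scope ring_scope.

(** Lower bound: k disjoint cycles of distinct lengths occupy at least
    3 + 4 + ... + (k + 2) = k (k + 5) / 2 vertices, too many for the complete
    graph on d' + 1 vertices when d' + 1 < k (k + 5) / 2.

    Upper bound: take p < k disjoint cycles of distinct lengths that miss some
    vertex, with minimum total length. A vertex v outside them has at most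
    3 + r neighbours on the member C that has exactly r strictly shorter members:
    otherwise v and an arc of C would form a cycle shorter than C whose length
    is not in use. Hence v sends at most 3 p + p (p - 1) / 2 edges to the family,
    and at least p + 2 edges to the rest of the graph. At the end of a longest path
    in the rest, p + 2 back edges close cycles of p + 1 different lengths, one
    of which is new. As long as p + 1 < k there is one more back edge, so
    the new cycle can be chosen not to use the whole path, and the enlarged
    family still misses a vertex. *)

(** * Counting in families of pairwise distinct numbers *)

Section NatFamilies.
Local Open Scope nat_scope.

Lemma size_enum_filter n (P : pred 'I_n) :
  size [seq j <- enum 'I_n | P j] = \sum_(j < n) P j.
Proof. by rewrite size_filter -sumn_count sumnE big_map big_enum. Qed.

(** Injectivity makes exactly one of [f j < f i] and [f i < f j] true for [i != j], so adding the
    sum to its transpose counts the [n * n - n] ordered pairs of distinct indices. *)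
Lemma sum_lt_pairs n (f : 'I_n -> nat) : injective f ->
  (\sum_(i < n) \sum_(j < n) (f j < f i)).*2 + n = n * n.
Proof.
move=> f_inj; rewrite -addnn [X in _ + X + _]exchange_big -big_split /=.
under eq_bigr => i _.
  rewrite -big_split /= (eq_bigr (fun j => (j != i) : nat)); last first.
    move=> j _; case: (eqVneq j i) => [->|]; first by rewrite ltnn.
    by rewrite -(inj_eq f_inj); case: ltngtP.
  rewrite -big_mkcond /= sum1_card cardC1 card_ord.
over.
by rewrite sum_nat_const card_ord; case: n {f f_inj} => // m; rewrite -mulnSr.
Qed.

Lemma sum_injective_ge m n (f : 'I_n -> nat) :
  injective f -> (forall i, m <= f i) ->
  (n * m).*2 + n * n <= (\sum_(i < n) f i).*2 + n.
Proof.
move=> f_inj f_ge; rewrite -(sum_lt_pairs f_inj) addnA leq_add2r.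
rewrite -doubleD leq_double -{1}(card_ord n) -sum_nat_const -big_split leq_sum //= => i _.
(* Termwise: the values below [f i] are distinct and lie in the interval from [m] to [f i - 1], so
   there are at most [f i - m] of them. *)
rewrite -leq_subRL ?f_ge //.
have -> : \sum_(j < n) (f j < f i) = size [seq f j | j <- enum 'I_n & f j < f i].
  by rewrite size_map size_enum_filter.
rewrite -(size_iota m (f i - m)); apply: uniq_leq_size.
  by rewrite map_inj_uniq // filter_uniq // enum_uniq.
move=> x /mapP[j]; rewrite mem_filter => /andP[lt_ji _] ->.
by rewrite mem_iota f_ge subnKC.
Qed.

Lemma sum_size_disjoint (T : finType) n (C : 'I_n -> seq T) :
  (forall i, uniq (C i)) -> (forall i j, i != j -> [disjoint C i & C j]) ->
  \sum_(i < n) size (C i) <= #|T|.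
Proof.
move=> C_uniq C_disj.
under eq_bigr => i _ do rewrite -(card_uniqP (C_uniq i)) -sum1_card big_mkcond.
(* Count incidences by vertex: each vertex lies on at most one member. *)
rewrite exchange_big /= -sum1_card leq_sum // => x _.
case: (pickP (fun i => x \in C i)) => [i xCi | xC]; last first.
  by rewrite big1 // => i _; rewrite xC.
rewrite (bigD1 i) //= xCi big1 // => j ji.
by rewrite (disjointFl (C_disj j i ji)).
Qed.

End NatFamilies.

(** * Cycles closed by the edges at an end of a path *)

Section Cycles.
Local Open Scope nat_scope.
Variable G : sgraph.
Implicit Types (v : G) (c q : seq G).

Definition disjoint_cycles_of_distinct_lengths p (C : 'I_p -> seq G) :=
  [/\ forall i, is_cycle (C i),
      forall i j, i != j -> [disjoint C i & C j]
    & forall i j, i != j -> size (C i) != size (C j)].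

Lemma is_cycle_uniq c : is_cycle c -> uniq c.
Proof. by case=> /andP[]. Qed.

Lemma close_path v q j :
  path (@adj G) v q -> uniq (v :: q) -> 0 < j -> j < size q ->
  adj v (nth v q j) -> is_cycle (v :: take j.+1 q).
Proof.
move=> pq uq j_gt0 lt_jq vj; split; last by rewrite /= size_take_min; lia.
apply/andP; split; last exact: (@take_uniq _ (v :: q) j.+2).
rewrite /cycle rcons_path take_path //= adj_sym (take_nth v) //.
by rewrite last_rcons.
Qed.

(* The cycles closed by the edges from v to its neighbours on q all have
   different lengths; 1 accounts for the first vertex of q, which closes none,
   and r for the last r vertices of q. *)
Lemma cycle_of_new_length v q (L : seq nat) r :
  path (@adj G) v q -> uniq (v :: q) ->
  (size L).+1 + r < count (adj v) q ->
  exists c, [/\ is_cycle c, {subset c <= v :: q}, size c \notin L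
              & size c + r <= (size q).+1].
Proof.
move=> pq uq lt_N.
pose J := [seq j <- iota 0 (size q) | adj v (nth v q j)].
have size_J : size J = count (adj v) q.
  by rewrite size_filter -[in RHS](mkseq_nth v q) count_map.
(* Position [j] closes a cycle of length [j + 2], so a length [l] in [L] rules out position [l - 2].
   As [bad] has [size L + 1 + r] entries, fewer than [J], some position in [J] avoids it. *)
pose bad := 0 :: [seq l - 2 | l <- L] ++ iota (size q - r) r.
have /hasP[j] : has [pred j | j \notin bad] J.
  apply/negPn/negP; rewrite -all_predC => /allP J_bad.
  suff : size J <= size bad by rewrite size_J /= size_cat size_map size_iota; lia.
  apply: uniq_leq_size; first by rewrite filter_uniq ?iota_uniq.
  by move=> j /J_bad /= /negPn.
rewrite mem_filter mem_iota /= => /andP[vj lt_jq].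
rewrite inE mem_cat mem_iota !negb_or => /and3P[j0 jL jr].
exists (v :: take j.+1 q); split.
- by apply: close_path; rewrite // lt0n.
- move=> x; rewrite !inE => /orP[->//|/mem_take->]; exact: orbT.
- apply: contra jL => jL; apply/mapP; exists j.+2; last by rewrite subn2.
  by move: jL; rewrite /= size_take_min (minn_idPl _).
- rewrite /= size_take_min; lia.
Qed.

Lemma maximal_path (D : pred G) v0 : D v0 ->
  exists v q, [/\ path (@adj G) v q, uniq (v :: q), all D (v :: q)
                & forall u, D u -> adj v u -> u \in q].
Proof.
move=> Dv0.
(* The path grows at its head; [m] bounds how often it still can. *)
suff ext m v q : #|G| <= m + size q -> path (@adj G) v q -> uniq (v :: q) ->
    all D (v :: q) ->
    exists v q, [/\ path (@adj G) v q, uniq (v :: q), all D (v :: q)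
                  & forall u, D u -> adj v u -> u \in q].
  by apply: (ext _ v0 [::] (leq_addr _ _)); rewrite //= Dv0.
elim: m v q => [|m IH] v q le_m pq uq Dq.
  have le_q : size (v :: q) <= #|G| by rewrite -(card_uniqP uq) max_card.
  by have := leq_ltn_trans le_m (leq_trans (ltnSn _) le_q); rewrite ltnn.
case: (pickP [pred u | [&& D u, adj v u & u \notin q]]) => [u | no_ext].
  case/and3P=> Du vu uNq.
  have uv : u != v by apply: contraTneq vu => ->; rewrite adj_irr.
  apply: (IH u (v :: q)) => //; last by apply/andP.
  - by rewrite addnS.
  - by rewrite /= adj_sym vu.
  - by rewrite cons_uniq uq inE negb_or uv uNq.
exists v, q; split=> // u Du vu; apply/negPn/negP => uNq.
by have := no_ext u; rewrite /= Du vu uNq.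
Qed.

(** * Enlarging and shortening families of disjoint cycles *)

Definition add_member p (c : seq G) (C : 'I_p -> seq G) (i : 'I_p.+1) : seq G :=
  oapp C c (unlift ord0 i).

Lemma sum_size_add_member p c (C : 'I_p -> seq G) :
  \sum_(i < p.+1) size (add_member c C i) = size c + \sum_(i < p) size (C i).
Proof.
rewrite big_ord_recl /add_member unlift_none; congr (_ + _).
by apply: eq_bigr => i _; rewrite liftK.
Qed.

(** Stated for arbitrary sequences because it is also applied to a path, to count the vertices it
    takes up next to the family. *)
Lemma add_member_disjoint p c (C : 'I_p -> seq G) :
  (forall i, [disjoint c & C i]) ->
  (forall i j, i != j -> [disjoint C i & C j]) ->
  forall i j, i != j -> [disjoint add_member c C i & add_member c C j].
Proof.
move=> cC C_disj i j; rewrite /add_member.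
case: unliftP => [i'|] ->; case: unliftP => [j'|] -> //=.
- by rewrite (inj_eq lift_inj); apply: C_disj.
- by rewrite disjoint_sym cC.
Qed.

Lemma replace_member p (C : 'I_p -> seq G) i c :
  disjoint_cycles_of_distinct_lengths C -> is_cycle c ->
  (forall j, j != i -> [disjoint c & C j]) ->
  (forall j, j != i -> size c != size (C j)) ->
  disjoint_cycles_of_distinct_lengths (fun j => if j == i then c else C j).
Proof.
case=> Ccyc Cdisj Csize ccyc cdisj csize; split=> [j | j l | j l].
- by case: ifP.
- move=> jl; case: (eqVneq j i) => [ji|ji]; case: (eqVneq l i) => [li|li].
  + by rewrite ji li eqxx in jl.
  + exact: cdisj.
  + by rewrite disjoint_sym cdisj.
  + exact: Cdisj.
- move=> jl; case: (eqVneq j i) => [ji|ji]; case: (eqVneq l i) => [li|li].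
  + by rewrite ji li eqxx in jl.
  + exact: csize.
  + by rewrite eq_sym csize.
  + exact: Csize.
Qed.

Lemma few_neighbours_or_shorter p (C : 'I_p -> seq G) v i :
  disjoint_cycles_of_distinct_lengths C -> (forall j, v \notin C j) ->
  count (adj v) (C i) <= 3 + \sum_(j < p) (size (C j) < size (C i)) \/
  exists2 C' : 'I_p -> seq G, disjoint_cycles_of_distinct_lengths C' &
    \sum_(j < p) size (C' j) < \sum_(j < p) size (C j).
Proof.
move=> goodC vC; case: (leqP (count (adj v) (C i))) => [|lt_N]; [by left | right].
have [Ccyc Cdisj Csize] := goodC.
have /hasP[u uCi vu] : has (adj v) (C i) by rewrite has_count; lia.
have [n q def_q] := rot_to uCi.
have ucyc_q : ucycle (@adj G) (u :: q) by rewrite -def_q rot_ucycle; case: (Ccyc i).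
have Ci_q : C i =i u :: q by move=> x; rewrite -def_q mem_rot.
have size_q : (size q).+1 = size (C i) by rewrite -(size_rot n (C i)) def_q.
have count_q : count (adj v) (u :: q) = count (adj v) (C i).
  by apply/permP; rewrite -def_q perm_rot.
pose L := [seq size (C j) | j <- enum 'I_p & size (C j) < size (C i)].
have size_L : size L = \sum_(j < p) (size (C j) < size (C i)).
  by rewrite size_map size_enum_filter.
(* The path [v :: u :: q] has one vertex more than [C i], so [r = 2] makes [c] strictly shorter than
   [C i]. Hence only the lengths of members shorter than [C i], collected in [L], have to be
   avoided. *)
have [|||c [ccyc cq cL size_c]] := @cycle_of_new_length v (u :: q) L 2.
- by case/andP: ucyc_q; rewrite /= vu rcons_path => /andP[].
- by rewrite cons_uniq -Ci_q vC; case/andP: ucyc_q.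
- by rewrite count_q size_L; lia.
have lt_c : size c < size (C i) by move: size_c; rewrite addn2 -size_q.
exists (fun j => if j == i then c else C j).
  apply: replace_member => // j ji.
    rewrite disjoint_subset; apply/subsetP => x /cq; rewrite !inE.
    case/orP=> [/eqP->|]; first exact: vC.
    by rewrite -(in_cons u q) -Ci_q => xCi; rewrite (disjointFl (Cdisj _ _ ji)).
  apply: contraNneq cL => eq_cj; rewrite eq_cj; apply/mapP; exists j => //.
  by rewrite mem_filter -eq_cj lt_c mem_enum.
rewrite (bigD1 i) //= eqxx [ltnRHS](bigD1 i) //= -addSn leq_add //.
by apply: leq_sum => j /negPf->.
Qed.

Lemma exists_outside p (C : 'I_p -> seq G) :
  \sum_(i < p) size (C i) < #|G| -> exists v, [forall i, v \notin C i].
Proof.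
move=> lt_C; case: (pickP [pred v | [forall i, v \notin C i]]) => [v|inC].
  by exists v.
move: lt_C; rewrite ltnNge => /negP[]; rewrite cardE.
have <- : size (flatten [seq C i | i <- enum 'I_p]) = \sum_(i < p) size (C i).
  by rewrite size_flatten /shape -map_comp sumnE big_map big_enum.
apply: uniq_leq_size; first exact: enum_uniq.
move=> v _; have /negbT := inC v; rewrite negb_forall => /existsP[i /negPn vCi].
by apply/flatten_mapP; exists i; rewrite ?mem_enum.
Qed.

(** The degree bound is twice [3p + p(p-1)/2], for the edges into the family, plus twice
    [p + 2 + r], for the back edges along the path. The parameter [r] is the number of vertices to
    be left uncovered. *)
Lemma extend_family p r (C : 'I_p -> seq G) :
  disjoint_cycles_of_distinct_lengths C -> \sum_(i < p) size (C i) < #|G| ->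
  (forall v : G, p * (p + 7) + 4 + r.*2 <= (degree v).*2) ->
  exists2 C' : 'I_p.+1 -> seq G, disjoint_cycles_of_distinct_lengths C' &
    \sum_(i < p.+1) size (C' i) + r <= #|G|.
Proof.
(* Induction on the total length stands in for the choice of a family of minimum total length. *)
have [n] := ubnP (\sum_(i < p) size (C i)).
elim: n C => // n IH C lt_n goodC lt_C deg_ge.
pose D v := [forall i, v \notin C i].
pose rk i := \sum_(j < p) (size (C j) < size (C i)).
case: (pickP [pred x : G * 'I_p | D x.1 && (3 + rk x.2 < count (adj x.1) (C x.2))]).
  case=> v i /= /andP[/forallP vC]; rewrite ltnNge => many.
  case: (few_neighbours_or_shorter i goodC vC) => [|[C' goodC' lt_C']].
    by rewrite (negPf many).
  by apply: (IH C') => //; lia.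
move=> few; have [Ccyc Cdisj Csize] := goodC.
have {}few v i : D v -> count (adj v) (C i) <= 3 + rk i.
  by move=> Dv; have /negbT := few (v, i); rewrite /= Dv -leqNgt.
have [v0 Dv0] := exists_outside lt_C.
have [v [q [pq uq Dq max_q]]] := @maximal_path D v0 Dv0.
have Dv : D v by case/andP: Dq.
have deg_v : degree v <= count (adj v) q + \sum_(i < p) count (adj v) (C i).
  have -> : \sum_(i < p) count (adj v) (C i) =
            size (flatten [seq filter (adj v) (C i) | i <- enum 'I_p]).
    rewrite size_flatten /shape -map_comp sumnE big_map big_enum /=.
    by under [RHS]eq_bigr do rewrite size_filter.
  rewrite -size_filter -size_cat /degree cardE; apply: uniq_leq_size.
    exact: enum_uniq.
  move=> u; rewrite mem_enum inE mem_cat mem_filter => vu; rewrite vu /=.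
  case: (boolP (D u)) => [Du|]; first by rewrite max_q.
  rewrite negb_forall => /existsP[i /negPn uCi]; apply/orP; right.
  by apply/flatten_mapP; exists i; rewrite ?mem_enum // mem_filter vu.
have sum_few : (\sum_(i < p) count (adj v) (C i)).*2 + p <= (p * 3).*2 + p * p.
  have size_inj : injective (fun i => size (C i)).
    by move=> i j eq_ij; apply: contraTeq isT => /Csize; rewrite eq_ij eqxx.
  rewrite -(sum_lt_pairs size_inj) addnA leq_add2r -doubleD leq_double.
  have -> : p * 3 = \sum_(i < p) 3 by rewrite sum_nat_const card_ord.
  by rewrite -big_split leq_sum // => i _; apply: few.
pose L := [seq size (C i) | i <- enum 'I_p].
have size_L : size L = p by rewrite size_map size_enum_ord.
have [|c [ccyc cq cL size_c]] := @cycle_of_new_length v q L r pq uq.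
  by rewrite size_L; have := deg_ge v; lia.
have qC i : [disjoint v :: q & C i].
  rewrite disjoint_subset; apply/subsetP => x /(allP Dq) /forallP/(_ i).
  by rewrite inE.
have cC i : [disjoint c & C i].
  by apply: disjointWl (qC i); apply/subsetP.
exists (add_member c C).
  split; last 2 first.
  - exact: add_member_disjoint.
  - have new i : size c != size (C i).
      by apply: contraNneq cL => ->; apply/map_f; rewrite mem_enum.
    move=> i j; rewrite /add_member.
    case: unliftP => [i'|] ->; case: unliftP => [j'|] -> //=.
    + by rewrite (inj_eq lift_inj); apply: Csize.
    + by move=> _; rewrite eq_sym new.
  - by move=> i; rewrite /add_member; case: unliftP => [j|] _ /=.
(* The whole path and the family fit together into [G], and [c] has at least [r] vertices fewer than
   the path. *)
have := @sum_size_disjoint _ _ (add_member (v :: q) C) _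
          (add_member_disjoint qC Cdisj).
rewrite !sum_size_add_member /=; set S := \sum_(i < p) _ => le_S.
rewrite addnAC; apply: leq_trans (leq_add size_c (leqnn S)) _.
apply: le_S => i; rewrite /add_member; case: unliftP => [j|] _ //=.
exact: is_cycle_uniq.
Qed.

Lemma disjoint_cycles_exist k : 0 < #|G| ->
  (forall v : G, k * (k + 5) <= (degree v).*2.+2) ->
  has_disjoint_cycles_of_distinct_lengths G k.
Proof.
move=> G_gt0 deg_ge.
have spare p : p < k -> exists2 C : 'I_p -> seq G,
    disjoint_cycles_of_distinct_lengths C & \sum_(i < p) size (C i) < #|G|.
  elim: p => [_|p IH lt_pk].
    by exists (fun=> [::]); rewrite ?big_ord0 //; split; case.
  have [C goodC lt_C] := IH (ltnW lt_pk).
  (* With [r = 1] the enlarged family misses a vertex again. *)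
  have [|C' goodC' le_C'] := @extend_family p 1 C goodC lt_C.
    by move=> v; have := deg_ge v; nia.
  by exists C' => //; rewrite -addn1.
case: k deg_ge spare => [|k] deg_ge spare.
  by exists (fun=> [::]); split; case.
have [C goodC lt_C] := spare k (ltnSn k).
(* The last cycle may use up all vertices. With [r = 0] the two degree bounds coincide:
   [(k+1)(k+6) - 2 = k(k+7) + 4]. *)
have [|C' goodC' _] := @extend_family k 0 C goodC lt_C.
  by move=> v; have := deg_ge v; nia.
by exists C'.
Qed.

Lemma disjoint_cycles_card k :
  has_disjoint_cycles_of_distinct_lengths G k -> k * (k + 5) <= #|G|.*2.
Proof.
case=> C [Ccyc Cdisj Csize].
have size_inj : injective (fun i => size (C i)).
  by move=> i j eq_ij; apply: contraTeq isT => /Csize; rewrite eq_ij eqxx.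
have size_ge3 i : 3 <= size (C i) by case: (Ccyc i).
have := sum_injective_ge size_inj size_ge3.
have := sum_size_disjoint (fun i => is_cycle_uniq (Ccyc i)) Cdisj.
by lia.
Qed.

Lemma min_degreeP d : 0 < #|G| ->
  reflect (forall v : G, d <= degree v) (d <= min_degree G).
Proof.
move=> G_gt0; apply: (iffP idP) => [le_d v | le_d].
  apply: leq_trans le_d _; rewrite /min_degree.
  elim: (index_enum _) (mem_index_enum v) => // u s IH; rewrite inE big_cons.
  case/orP=> [/eqP->|/IH]; first exact: geq_minl.
  exact: leq_trans (geq_minr _ _).
(* The default value [#|G|] of the minimum must be at least [d] too; it exceeds the degree of any
   vertex [v0]. *)
have [v0 _] := card_gt0P G_gt0.
rewrite /min_degree; elim/big_ind: _ => // [|x y]; last by rewrite leq_min => ->.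
exact: leq_trans (le_d v0) (max_card _).
Qed.

End Cycles.

(** * Complete graphs, the extremal examples *)

Section CompleteGraph.
Local Open Scope nat_scope.
Variable n : nat.

Fact neq_sym : symmetric (fun i j : 'I_n => i != j).
Proof. by move=> i j; rewrite eq_sym. Qed.

Fact neq_irr : irreflexive (fun i j : 'I_n => i != j).
Proof. by move=> i; rewrite eqxx. Qed.

Definition complete_graph := SGraph neq_sym neq_irr.

Lemma degree_complete_graph (v : complete_graph) : degree v = n.-1.
Proof.
rewrite /degree -[in RHS](card_ord n) -(cardC1 v); apply: eq_card => u.
by rewrite !inE /= eq_sym.
Qed.

End CompleteGraph.

(** * The value of f(k) *)

Lemma is_f_of_double (k d : nat) : (d.*2.+2 = k * (k + 5))%N -> is_f k d.
Proof.
move=> def_d; split=> [G G_gt0 /min_degreeP deg_ge | d' forced].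
  by apply: disjoint_cycles_exist => // v; rewrite -def_d ltnS ltnS leq_double deg_ge.
(* The complete graph on [d' + 1] vertices has minimum degree [d'], so the vertex count gives
   [2d + 2 <= 2(d' + 1)]. *)
have K_gt0 : (0 < #|complete_graph d'.+1|)%N by rewrite card_ord.
have := forced _ K_gt0; case: min_degreeP => // [_ /(_ isT) | []]; last first.
  by move=> v; rewrite degree_complete_graph.
by move/disjoint_cycles_card; rewrite card_ord -def_d; lia.
Qed.

Theorem theorem2p12 (k : nat) (hk : (1 <= k)%N) :
  (exists d : nat, is_f k d) /\
  (forall d : nat, is_f k d ->
     d%:R = (k%:R ^+ 2 + 5 * k%:R - 2) / 2 :> rat).
Proof.
have [d0 def_d0] : exists d0, (d0.*2.+2 = k * (k + 5))%N.
  (* The product is even, as [k] and [k + 5] have opposite parity, and positive by [hk], so neither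
     the halving nor the predecessor truncates. *)
  exists (k * (k + 5))./2.-1; move: (odd_double_half (k * (k + 5))).
  by rewrite oddM oddD /=; case: (odd k) => /=; nia.
have f_d0 := is_f_of_double def_d0; split=> [|d f_d]; first by exists d0.
have -> : d = d0.
  by case: f_d f_d0 => fd min_d [fd0 min_d0]; apply/anti_leq; rewrite min_d ?min_d0.
have := congr1 (fun n => n%:R : rat) def_d0.
rewrite /= -addn2 -mul2n !(natrD, natrM) => def_d0R.
apply: (mulIf (x := 2)) => //; rewrite divfK //.
rewrite -[LHS](addrK 2) [_ * 2]mulrC def_d0R; ring.
Qed.
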